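(* Let $H=(V,E)$ be a connected hypergraph with $|V|\ge2$. Then $H$ is homogeneous (i.e. the optimal density $\tilde\eta^*$ of $\operatorname{Mod}_2(\widehat\Omega(H))$ is a constant vector, where $\Omega(H)$ is the multi-tree family of $H$) if and only if its strength coincides with its fractional arboricity, i.e. $S(H)=D(H)$.
   Context: A hypergraph $H=(V,E)$ has a finite nonempty vertex set $V$ and a finite collection $E$ of subsets of $V$ (hyperedges), where repetitions are allowed (parallel hyperedges are distinct elements of $E$) and every hyperedge has at least two vertices. $H$ is connected if for every nonempty proper subset $X\subset V$ some hyperedge intersects both $X$ and $V\setminus X$. For $X\subseteq V$, $E[X]$ is the set of hyperedges contained in $X$. For a partition $\mathscr P$ of $V$ into nonempty parts, $|\mathscr P|$ is the number of parts and $\delta(\mathscr P)$ is the set of hyperedges intersecting at least two parts. Strength: $S(H)=\min\left\{\frac{|\delta(\mathscr P)|}{|\mathscr P|-1}:\mathscr P\text{ a partition of }V,\ |\mathscr P|\ge2\right\}$. Fractional arboricity: $D(H)=\max\left\{\frac{|E[X]|}{|X|-1}:X\subseteq V,\ |X|\ge2\right\}$. A set (or multiset) $F$ of hyperedges is a hyperforest if for every nonempty $X\subseteq V$ at most $|X|-1$ members of $F$ (counted with multiplicity) are contained in $X$; a hypertree is a hyperforest with $|F|=|V|-1$. For a multiset $A$ from $E$, $H[A]$ is the hypergraph with vertex set $\bigcup_{e\in A}e$ and hyperedges the members of $A$ (copies being parallel hyperedges), and $x^A\in\mathbb{R}^E_{\ge0}$ has $x^A(e)$ equal to the multiplicity of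 $e$ in $A$. The multi-tree family $\Omega(H)$ is the set of all $x^A$ such that $H[A]$ is a hypertree with vertex set $V$. For a family $\Gamma\subset\mathbb{R}^E_{\ge0}$, $\operatorname{Adm}(\Gamma)=\{\rho\in\mathbb{R}^E_{\ge0}:\gamma^T\rho\ge1\ \forall\gamma\in\Gamma\}$; the Fulkerson blocker family $\widehat\Gamma$ is the set of extreme points of $\operatorname{Adm}(\Gamma)$; $\operatorname{Mod}_2(\Gamma)=\inf_{\rho\in\operatorname{Adm}(\Gamma)}\sum_{e\in E}\rho(e)^2$, and its optimal density is the unique minimizer. *)

(* Defs.v *)
From mathcomp Require Export all_boot all_order all_algebra.
From mathcomp Require Export boolp classical_sets reals.
Set Implicit Arguments.
Unset Strict Implicit.
Unset Printing Implicit Defensive.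
Import Order.TTheory GRing.Theory Num.Theory.
Local Open Scope classical_set_scope.
Local Open Scope ring_scope.

(* Hyperedges are labels carrying a vertex set, so that parallel hyperedges
   (distinct labels with the same vertex set) are allowed. *)
Record hypergraph := Hypergraph {
  vertex : finType;
  hyperedge : finType;
  ends : hyperedge -> {set vertex};
  vertex_gt0 : (0 < #|vertex|)%N;
  ends_gt1 : forall e, (1 < #|ends e|)%N }.

Section Combinatorics.
Variable H : hypergraph.
Local Notation V := (vertex H).
Local Notation E := (hyperedge H).

Definition connected : Prop :=
  forall X : {set V}, X != finset.set0 -> X != finset.setT ->
    exists e : E, ends e :&: X != finset.set0 /\ ends e :&: ~: X != finset.set0.

Definition edges_in (X : {set V}) : {set E} :=
  [set e | ends e \subset X]%SET.

Definition edges_across (P : {set {set V}}) : {set E} :=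
  [set e | (2 <= #|[set B in P | ends e :&: B != finset.set0]|)%N]%SET.

(* A multiset of hyperedges is given by its multiplicity function. *)
Definition mset_hyperforest (A : {ffun E -> nat}) : Prop :=
  forall X : {set V}, X != finset.set0 ->
    (\sum_(e in edges_in X) A e <= #|X| - 1)%N.

Definition mset_vertices (A : {ffun E -> nat}) : {set V} :=
  (\bigcup_(e | (0 < A e)%N) ends e)%SET.

(* H[A] is a hypertree whose vertex set is the whole of V; since H[A] then has
   vertex set V, the hyperforest condition on H[A] ranges over subsets of V. *)
Definition spanning_multi_tree (A : {ffun E -> nat}) : Prop :=
  [/\ mset_vertices A = finset.setT, mset_hyperforest A
    & (\sum_e A e = #|V| - 1)%N].

(* When |V| >= 2, the two sets below are finite and nonempty, so that the
   infimum is a minimum and the supremum a maximum. *)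
Definition strength (R : realType) : R :=
  inf [set #|edges_across P|%:R / (#|P|%:R - 1) | P in
        [set P : {set {set V}} | finset.partition P finset.setT && (2 <= #|P|)%N]].

Definition fractional_arboricity (R : realType) : R :=
  sup [set #|edges_in X|%:R / (#|X|%:R - 1) | X in
        [set X : {set V} | (2 <= #|X|)%N]].

Definition multi_tree_family (R : realType) : set {ffun E -> R} :=
  [set [ffun e => (A e)%:R] | A in [set A | spanning_multi_tree A]].

End Combinatorics.

Arguments multi_tree_family H R : clear implicits.

Section Modulus.
Variables (R : realType) (E : finType).
Implicit Types (Gamma C : set {ffun E -> R}) (rho : {ffun E -> R}).

Definition Adm Gamma : set {ffun E -> R} :=
  [set rho | (forall e, 0 <= rho e) /\
             (forall gamma, Gamma gamma -> 1 <= \sum_e gamma e * rho e)].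

Definition extreme_points C : set {ffun E -> R} :=
  [set x | C x /\ forall y z (t : R), C y -> C z -> 0 < t < 1 ->
             (forall e, x e = t * y e + (1 - t) * z e) -> y = x /\ z = x].

Definition blocker Gamma : set {ffun E -> R} := extreme_points (Adm Gamma).

Definition energy2 rho : R := \sum_e rho e ^+ 2.

Definition Mod2 Gamma : R := inf [set energy2 rho | rho in Adm Gamma].

Definition Mod2_minimizer Gamma rho : Prop :=
  Adm Gamma rho /\ energy2 rho = Mod2 Gamma.

Definition optimal_density Gamma rho : Prop :=
  Mod2_minimizer Gamma rho /\
  forall rho', Mod2_minimizer Gamma rho' -> rho' = rho.

End Modulus.

Definition homogeneous (R : realType) (H : hypergraph) : Prop :=
  exists eta : {ffun hyperedge H -> R},
    optimal_density (blocker (multi_tree_family H R)) eta /\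
    exists c : R, forall e, eta e = c.

(* Main.v *)
(* Let c0 = (|V|-1)/|E|. Both sides are equivalent to the sparsity condition
   c0 |E[X]| <= |X| - 1 for all nonempty X.
   Taking X = V and the partition into singletons gives S <= 1/c0 <= D, so S = D
   forces D = 1/c0, which is sparsity; conversely sparsity on the blocks of a
   partition P gives c0 |delta(P)| >= |P| - 1, hence S = D = 1/c0.
   For homogeneity, every vector of Adm(Omega) may be paired with Adm(blocker),
   because a nonnegative linear form on Adm(Omega) is bounded below by its value
   at some extreme point. If the constant c is optimal, comparing it with a
   spanning multi-tree gives c <= c0, and pairing it with the normalised
   indicator of E \ E[X] gives sparsity. If sparsity holds, the greedy spanning
   multi-tree for the weight rho weighs at most c0 (sum of rho), so the constant
   c0 is admissible, and pairing with the constant 1/(|V|-1) and completing the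
   square shows that it is the unique minimizer. *)

Require Import Defs.
From mathcomp Require Import zify ring lra.
Set Implicit Arguments.
Unset Strict Implicit.
Unset Printing Implicit Defensive.
Import Order.TTheory GRing.Theory Num.Theory.

(** * Contraction of a subset to one of its points *)

Section Collapse.
Variable T : finType.
Implicit Types (Y Z : {set T}) (x y : T).

(** The default [x] is never reached, since [Y] contains [x] in that branch. Staying inside [T] lets
    successive contractions be composed. *)
Definition collapse Y x : T := if x \in Y then odflt x [pick y in Y] else x.

Lemma collapse_eq Y x y : x \in Y -> y \in Y -> collapse Y x = collapse Y y.
Proof.
by rewrite /collapse => xY yY; rewrite xY yY; case: pickP => //= /(_ x); rewrite xY.
Qed.

Lemma card_collapse Y Z : Y != finset.set0 -> Y \subset Z ->
  #|collapse Y @: Z| + #|Y|.-1 = #|Z|.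
Proof.
move=> /set0Pn[y yY] sYZ.
have -> : (collapse Y @: Z = collapse Y y |: (Z :\: Y))%SET.
  apply/setP=> z; rewrite !inE; apply/imsetP/orP.
    case=> x xZ ->; case: (boolP (x \in Y)) => xY.
      by left; rewrite (collapse_eq xY yY).
    by right; rewrite /collapse (negPf xY) xY.
  case=> [/eqP ->|/andP[zY zZ]]; first by exists y => //; apply: (fintype.subsetP sYZ).
  by exists z => //; rewrite /collapse (negPf zY).
have cY : collapse Y y \in Y.
  by rewrite /collapse yY; case: pickP => //= /(_ y); rewrite yY.
have Y0 : 0 < #|Y| by apply/card_gt0P; exists y.
have := subset_leq_card sYZ.
rewrite cardsU1 inE cY /= cardsD (finset.setIidPr sYZ); lia.
Qed.

End Collapse.

(** * Greedy spanning multi-trees *)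

Section Greedy.
Variable H : hypergraph.
Local Notation V := (vertex H).
Local Notation E := (hyperedge H).
Implicit Types (s : seq E) (e : E) (X : {set V}).

Lemma ends_inhabited e : exists v, v \in ends e.
Proof. by apply/card_gt0P; apply: ltnW (ends_gt1 e). Qed.

(* Processing s from its tail to its head, [label s] merges the vertices of each
   processed hyperedge, so its fibres are the components of (V, s); [greedy s e]
   is the number of components lost when e is processed. *)
Fixpoint label s : V -> V :=
  if s is e :: s' then collapse (label s' @: ends e) \o label s' else id.

Definition gain s e : nat := #|label s @: ends e|.-1.

Fixpoint greedy s : E -> nat :=
  if s is e0 :: s' then fun e => greedy s' e + (e == e0) * gain s' e0
  else fun=> 0.

Lemma card_label_cons s e X : ends e \subset X ->
  #|label (e :: s) @: X| + gain s e = #|label s @: X|.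
Proof.
move=> eX; rewrite /= imset_comp card_collapse //; last exact: imsetS.
have [v ve] := ends_inhabited e.
by apply/set0Pn; exists (label s v); apply: imset_f.
Qed.

Lemma sum_greedy_cons s e (P : pred E) :
  \sum_(e' | P e') greedy (e :: s) e' = \sum_(e' | P e') greedy s e' + P e * gain s e.
Proof.
rewrite /= big_split /=; congr (_ + _).
case: (boolP (P e)) => Pe.
  rewrite (bigD1 e) //= eqxx big1 ?addn0 // => e' /andP[_ /negPf ->].
  by rewrite mul0n.
by rewrite big1 // => e' Pe'; case: eqP => // e'e; rewrite -e'e Pe' in Pe.
Qed.

(** Processing a hyperedge inside [X] lowers the number of labels on [X] by exactly its gain; any
    other hyperedge cannot raise it. As a nonempty [X] keeps at least one label, this gives the
    hyperforest bound. *)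
Lemma sum_greedy_in s X :
  \sum_(e in edges_in X) greedy s e + #|label s @: X| <= #|X|.
Proof.
elim: s => [|e s IHs]; first by rewrite /= big1 // imset_id.
apply: leq_trans IHs; rewrite sum_greedy_cons -addnA leq_add2l.
case: (boolP (e \in edges_in X)) => [|_].
  by rewrite inE => /(card_label_cons s) <-; rewrite mul1n addnC.
by rewrite /= imset_comp leq_imset_card.
Qed.

Lemma sum_greedy s : \sum_e greedy s e + #|label s @: finset.setT| = #|V|.
Proof.
elim: s => [|e s IHs]; first by rewrite /= big1 // imset_id cardsT.
by have := card_label_cons s (finset.subsetT (ends e)); rewrite sum_greedy_cons; lia.
Qed.

Lemma label_ends s e u v :
  e \in s -> u \in ends e -> v \in ends e -> label s u = label s v.
Proof.
move=> + ue ve; elim: s => //= e0 s IHs; rewrite in_cons => /predU1P[<-|/IHs -> //].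
by apply: collapse_eq; apply: imset_f.
Qed.

(** If [v] were uncovered, all |V| - 1 members of [A] would lie in the complement of [v], which may
    contain at most |V| - 2 of them. *)
Lemma spanning_multi_treeP (A : {ffun E -> nat}) : 2 <= #|V| ->
  mset_hyperforest A -> \sum_e A e = #|V| - 1 -> spanning_multi_tree A.
Proof.
move=> V2 forA sumA; split=> //; apply/eqP; rewrite -finset.subTset.
apply/fintype.subsetP=> v _; apply: contraT => vA.
have C0 : [set~ v]%SET != finset.set0 by rewrite -card_gt0 cardsC1; lia.
have := forA _ C0; rewrite cardsC1 leqNgt => /negP[].
suff -> : \sum_(e in edges_in [set~ v]) A e = #|V| - 1 by lia.
rewrite -sumA [RHS](bigID [in edges_in [set~ v]]) /= [X in _ = _ + X]big1 ?addn0 // => e.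
rewrite inE; case: (posnP (A e)) => // Ae /negP[].
apply/fintype.subsetP => u ue; rewrite !inE; apply: contraNneq vA => <-.
by apply/bigcupP; exists e.
Qed.

Lemma greedy_spanning s : connected H -> 2 <= #|V| -> (forall e, e \in s) ->
  spanning_multi_tree [ffun e => greedy s e].
Proof.
move=> connH V2 s_all; have [v0 _] := card_gt0P (vertex_gt0 H).
(* A hyperedge leaving the label class of [v0] would carry two labels, against [label_ends]; by
   connectedness the class is all of V. *)
have label_cst v : label s v = label s v0.
  apply/eqP; apply: contraT => Nv.
  have [||e [/set0Pn[u /finset.setIP[ue]] + /set0Pn[w /finset.setIP[we]]]] :=
    connH [set u | label s u == label s v0]%SET.
  - by apply/set0Pn; exists v0; rewrite inE.
  - by apply: contraNneq Nv => /setP/(_ v); rewrite !inE.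
  by rewrite !inE (label_ends (s_all e) we ue) => ->.
apply: spanning_multi_treeP => // [X /set0Pn[x xX]|].
- under eq_bigr do rewrite ffunE.
  have : 0 < #|label s @: X| by apply/card_gt0P; exists (label s x); apply: imset_f.
  by have := sum_greedy_in s X; lia.
under eq_bigr do rewrite ffunE.
have /cards1P/eqP : exists x, label s @: finset.setT = [set x]%SET.
  exists (label s v0); apply/setP=> y; rewrite inE; apply/imsetP/eqP.
    by case=> x _ ->.
  by move=> ->; exists v0.
by have := sum_greedy s; lia.
Qed.

End Greedy.

(** * Minimizing a nonnegative linear form at extreme points *)

Section ExtremePoints.
Local Open Scope classical_set_scope.
Local Open Scope ring_scope.
Variables (R : realType) (E : finType).
Implicit Types (x y z eta rho : {ffun E -> R}) (d : E -> R).

(** As in the simplex method, [s] is the least ratio of [p j] to [- q j] over the decreasing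
    coordinates; the second hypothesis keeps it positive. *)
Lemma ratio_test (J : finType) (p q : J -> R) :
    (forall j, 0 <= p j) -> (forall j, p j = 0 -> q j = 0) -> (exists j, q j < 0) ->
  exists2 s, 0 < s & (forall j, 0 <= p j + s * q j) /\
                     exists2 j, p j != 0 & p j + s * q j = 0.
Proof.
move=> p0 pq [j0 qj0].
have p_gt0 j : q j < 0 -> 0 < p j.
  by move=> qj; rewrite lt_def p0 andbT; apply: contraTneq qj => /pq ->; rewrite ltxx.
pose r j := p j / - q j.
case: (@arg_minP _ _ _ j0 (fun j => q j < 0) r qj0) => k qk rk.
exists (r k); first by rewrite divr_gt0 ?oppr_gt0 ?p_gt0.
have rE j : q j < 0 -> r j * q j = - p j.
  by move=> qj; rewrite /r invrN mulrN mulNr divfK // lt_eqF.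
split=> [j|]; last by exists k; rewrite ?rE ?subrr // gt_eqF ?p_gt0.
have [qj|qj] := ltP (q j) 0; last first.
  by rewrite addr_ge0 // mulr_ge0 // /r divr_ge0 // oppr_ge0 ltW.
by rewrite -[p j]opprK -rE // addrC subr_ge0 ler_nM2r // rk.
Qed.

(* While the point is not extreme, move it along a segment through it, in the
   direction that does not increase the objective and decreases some coordinate,
   until one more constraint becomes tight. *)
Lemma extreme_point_below (I : finType) (G : I -> {ffun E -> R}) eta rho :
    (forall e, 0 <= eta e) -> Adm (range G) rho ->
  exists2 x, extreme_points (Adm (range G)) x &
    \sum_e eta e * x e <= \sum_e eta e * rho e.
Proof.
move=> eta0.
(* [p] collects the slacks of all constraints, nonnegativity included, and [q] their rates of change
   along a direction. *)
pose p x (j : E + I) :=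
  match j with inl e => x e | inr i => \sum_e G i e * x e - 1 end.
pose q d (j : E + I) :=
  match j with inl e => d e | inr i => \sum_e G i e * d e end.
have AdmP x : Adm (range G) x <-> forall j, 0 <= p x j.
  split=> [[x0 Gx] [e|i] //=|px].
    by rewrite subr_ge0; apply: Gx; exists i.
  by split=> [e|_ [i _ <-]]; [exact: px (inl e)|rewrite -subr_ge0; exact: px (inr i)].
have pqD x d s j : p [ffun e => x e + s * d e] j = p x j + s * q d j.
  case: j => [e|i] /=; first by rewrite ffunE.
  rewrite addrAC mulr_sumr -big_split /=; congr (_ - _).
  by apply: eq_bigr => e _; rewrite ffunE; ring.
pose m x := #|[set j | p x j != 0]%SET|.
have [n] := ubnP (m rho); elim: n rho => // n IHn x mx Ax.
have [ex|Nex] := pselect (extreme_points (Adm (range G)) x); first by exists x.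
have [y [z [t [Ay Az /andP[t0 t1] xE yz]]]] : exists y z (t : R),
  [/\ Adm (range G) y, Adm (range G) z, 0 < t < 1,
      forall e, x e = t * y e + (1 - t) * z e & y <> z].
  apply: contrapT => Nyz; apply: Nex; split=> // y z t Ay Az t01 xE.
  have yz : y = z.
    by apply: contrapT => yz; apply: Nyz; exists y, z, t.
  by split; [rewrite yz|]; apply/ffunP=> e; rewrite xE yz; ring.
pose d e := y e - z e.
have pE j : p x j = t * p y j + (1 - t) * p z j.
  case: j => [e|i] /=; first exact: xE.
  rewrite (_ : \sum_e G i e * x e =
    t * (\sum_e G i e * y e) + (1 - t) * \sum_e G i e * z e); first by ring.
  by rewrite !mulr_sumr -big_split; apply: eq_bigr => e _; rewrite xE /=; ring.
have qE j : q d j = p y j - p z j.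
  case: j => [e|i] //=; rewrite (_ : \sum_e G i e * d e =
    \sum_e G i e * y e - \sum_e G i e * z e); first by ring.
  by rewrite -sumrB; apply: eq_bigr => e _; rewrite /d mulrBr.
(* Since [x] is a proper convex combination of [y] and [z], a constraint tight at [x] is tight at
   both, hence constant along [d]. *)
have tight j : p x j = 0 -> q d j = 0.
  have /AdmP/(_ j) := Ay; have /AdmP/(_ j) := Az.
  rewrite pE qE => pz py /eqP.
  rewrite paddr_eq0 ?mulr_ge0 ?subr_ge0 ?(ltW t0) ?(ltW t1) //.
  rewrite !mulf_eq0 subr_eq0 (gt_eqF t0) (gt_eqF t1) /= => /andP[/eqP -> /eqP ->].
  by rewrite subrr.
(* If the objective varies along [d], orient [d] so that it drops; as [eta] is nonnegative, some
   coordinate then drops too. If it is constant, the factor [- d e] makes coordinate [e] drop. *)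
have [sg [ed [e0 de0]]] : exists sg : R,
    \sum_e eta e * (sg * d e) <= 0 /\ exists e, sg * d e < 0.
  have key sg : \sum_e eta e * (sg * d e) < 0 -> exists e, sg * d e < 0.
    move=> lt0; apply: contrapT => Ne; move: lt0; rewrite ltNge => /negP[].
    apply: sumr_ge0 => e _; rewrite mulr_ge0 // leNgt; apply/negP => de.
    by apply: Ne; exists e.
  have [e de] : exists e, d e != 0.
    apply: contrapT => Ne; apply: yz; apply/ffunP=> e; apply/eqP.
    by rewrite -subr_eq0; apply: contraT => de; case: Ne; exists e.
  have sgE sg : \sum_e eta e * (sg * d e) = sg * \sum_e eta e * d e.
    by rewrite mulr_sumr; apply: eq_bigr => ? _; ring.
  have [lt0|gt0|eq0] := ltgtP (\sum_e eta e * d e) 0.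
  - have sE : \sum_e eta e * (1 * d e) < 0 by rewrite sgE mul1r.
    by exists 1; split; [exact: ltW|exact: key sE].
  - have sE : \sum_e eta e * (-1 * d e) < 0 by rewrite sgE mulN1r oppr_lt0.
    by exists (-1); split; [exact: ltW|exact: key sE].
  - exists (- d e); rewrite sgE eq0 mulr0 lexx; split=> //; exists e.
    by rewrite mulNr oppr_lt0 -expr2 exprn_even_gt0.
pose d' e := sg * d e.
have qd' j : q d' j = sg * q d j.
  by case: j => //= i; rewrite mulr_sumr; apply: eq_bigr => e _; rewrite /d'; ring.
have [|j||s s0 [feas [k pk pqk]]] := @ratio_test _ (p x) (q d').
- by apply/AdmP.
- by rewrite qd' => /tight ->; rewrite mulr0.
- by exists (inl e0).
pose x' := [ffun e => x e + s * d' e].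
have [||x'' ex le] := IHn x'.
- apply: (@leq_trans (m x)) => //; apply: proper_card; apply/properP; split.
    apply/fintype.subsetP=> j; rewrite !inE pqD; apply: contraNneq => /[dup] pj /tight qj.
    by rewrite qd' pj qj !mulr0 addr0.
  by exists k; rewrite !inE // pqD pqk eqxx.
- by apply/AdmP => j; rewrite pqD.
exists x'' => //; apply: le_trans le _.
rewrite (_ : \sum_e eta e * x' e =
  \sum_e eta e * x e + s * \sum_e eta e * d' e); last first.
  by rewrite mulr_sumr -big_split; apply: eq_bigr => e _; rewrite ffunE /=; ring.
by rewrite gerDl pmulr_rle0.
Qed.

End ExtremePoints.

(** * Sparsity, light multi-trees and pairing with the blocker *)

Section Homogeneity.
Local Open Scope ring_scope.
Variables (R : realType) (H : hypergraph).
Local Notation V := (vertex H).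
Local Notation E := (hyperedge H).
Local Notation Omega := (multi_tree_family H R).
Implicit Types (A : {ffun E -> nat}) (X : {set V}) (rho eta : {ffun E -> R}).

Definition sparse (c : R) : Prop :=
  forall X, X != finset.set0 -> c * #|edges_in X|%:R <= #|X|%:R - 1.

(** Each hyperedge of [F] lies inside one fibre of [f], so it suffices to sum the sparsity bounds of
    the fibres. The colouring [f] will be a component labelling or the block map of a partition. *)
Lemma sparse_monochromatic c (T : finType) (f : V -> T) (F : {set E}) :
    0 <= c -> sparse c ->
    (forall e u v, e \in F -> u \in ends e -> v \in ends e -> f u = f v) ->
  c * #|F|%:R <= #|V|%:R - #|f @: finset.setT|%:R.
Proof.
move=> c0 spc fF; set I := (f @: finset.setT)%SET.
have f_I v : f v \in I by apply: imset_f; rewrite inE.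
pose g e := f (xchoose (ends_inhabited e)).
have gF e u : e \in F -> u \in ends e -> f u = g e.
  by move=> eF ue; apply: fF eF ue (xchooseP (ends_inhabited e)).
have -> : #|V| = (\sum_(y in I) #|f @^-1: [set y]|)%N.
  rewrite -sum1_card (partition_big f [in I]) //=.
  by apply: eq_bigr => y _; rewrite -sum1_card; apply: eq_bigl => v; rewrite !inE.
have -> : #|F| = (\sum_(y in I) #|[set e in F | g e == y]|)%N.
  rewrite -sum1_card (partition_big g [in I]) /= => [|e _]; last exact: f_I.
  by apply: eq_bigr => y _; rewrite -sum1_card; apply: eq_bigl => e; rewrite !inE.
rewrite -[#|I|]sum1_card !natr_sum mulr_sumr -sumrB; apply: ler_sum => y /imsetP[v _ ->].
have /spc : (f @^-1: [set f v])%SET != finset.set0.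
  by apply/set0Pn; exists v; rewrite !inE.
apply: le_trans; rewrite ler_wpM2l // ler_nat subset_leq_card //.
apply/fintype.subsetP => e; rewrite !inE => /andP[eF /eqP <-].
by apply/fintype.subsetP => u ue; rewrite !inE (gF e).
Qed.

(* Abel summation along the sorted list; by sparsity every partial sum of
   c - greedy is nonpositive. *)
Lemma sum_greedy_weight c (rho : E -> R) (s : seq E) (M : R) :
    0 <= c -> sparse c -> uniq s -> sorted (fun a b => rho b <= rho a) s ->
    (forall e, e \in s -> rho e <= M) ->
  M * (c * (size s)%:R - (\sum_e greedy s e)%:R) <=
    c * (\sum_(e <- s) rho e) - \sum_e (greedy s e)%:R * rho e.
Proof.
move=> c0 spc; elim: s M => [|e s IHs] M us ss le_M.
  by rewrite big_nil !big1 ?mulr0 ?subrr ?mulr0 // => e _; rewrite mul0r.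
(* Every listed hyperedge has a single label, and by [sum_greedy] the total gain is |V| minus the
   number of labels. *)
have le0 : c * (size (e :: s))%:R - (\sum_e' greedy (e :: s) e')%:R <= 0.
  have /(sparse_monochromatic c0 spc) : forall e' u v, e' \in [set e' in e :: s]%SET ->
      u \in ends e' -> v \in ends e' -> label (e :: s) u = label (e :: s) v.
    by move=> e' u v; rewrite inE => e's; apply: label_ends e's.
  by rewrite cardsE (card_uniqP us) -(sum_greedy (e :: s)) natrD addrK subr_le0.
have tr : transitive (fun a b => rho b <= rho a).
  by move=> b a b'; move=> ab bb'; apply: le_trans bb' ab.
have le_e : forall e', e' \in s -> rho e' <= rho e.
  by apply/allP; apply: order_path_min ss.
have /andP[_ us'] := us.
have IH := IHs (rho e) us' (path_sorted ss) le_e.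
have le_eM : rho e <= M by apply: le_M; rewrite mem_head.
(* By [le0], lowering [M] to [rho e] can only raise the product; [rho e] still bounds the tail, so
   [IH] applies. *)
apply: (@le_trans _ _ (rho e * (c * (size (e :: s))%:R - (\sum_e' greedy (e :: s) e')%:R))).
  by rewrite ler_wnM2r.
have -> : \sum_e' (greedy (e :: s) e')%:R * rho e' =
    \sum_e' (greedy s e')%:R * rho e' + (gain s e)%:R * rho e.
  rewrite /= (eq_bigr (fun e' => (greedy s e')%:R * rho e' +
      ((e' == e) * gain s e)%:R * rho e')) => [|e' _]; last by rewrite natrD mulrDl.
  rewrite big_split /=; congr (_ + _); rewrite (bigD1 e) //= eqxx mul1n big1 ?addr0 //.
  by move=> e' /negPf ->; rewrite mul0n mul0r.
rewrite sum_greedy_cons mul1n big_cons /= -natr1 natrD.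
lra.
Qed.

(** Decreasing order puts the light hyperedges at the tail, where the greedy process starts. On the
    full list the coefficient of [M] in [sum_greedy_weight] vanishes, so any upper bound serves as
    [M]. *)
Lemma light_spanning_multi_tree c (rho : E -> R) :
    connected H -> (2 <= #|V|)%N -> 0 <= c -> sparse c -> c * #|E|%:R = #|V|%:R - 1 ->
  exists2 A, spanning_multi_tree A & \sum_e (A e)%:R * rho e <= c * \sum_e rho e.
Proof.
move=> connH V2 c0 spc cE; pose r := fun a b : E => rho b <= rho a.
pose s := sort r (enum E); have sE e : e \in s by rewrite mem_sort mem_enum.
have treeA := greedy_spanning connH V2 sE.
exists [ffun e => greedy s e] => //; rewrite -subr_ge0.
pose M := \sum_e `|rho e|.
have le_M e : e \in s -> rho e <= M.
  move=> _; apply: le_trans (ler_norm _) _.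
  by rewrite /M (bigD1 e) //= lerDl sumr_ge0.
have tot : total r by move=> a b; apply: le_total.
have us : uniq s by rewrite sort_uniq enum_uniq.
have := sum_greedy_weight c0 spc us (sort_sorted tot _) le_M.
have [_ _] := treeA; under eq_bigr do rewrite ffunE.
move=> ->; rewrite size_sort -cardE cE natrB ?(ltnW V2) // subrr mulr0.
rewrite (perm_big _ (permEl (perm_sort r _))) big_enum /=.
by under [X in _ -> 0 <= _ - X]eq_bigr do rewrite ffunE.
Qed.

(** Multiplicities in a spanning multi-tree are below |V|, so the family is finite, as
    [extreme_point_below] requires. *)
Lemma multi_tree_family_range :
  exists (I : finType) (G : I -> {ffun E -> R}), Omega = (range G)%classic.
Proof.
pose nat_of (A : {ffun E -> 'I_#|V|}) : {ffun E -> nat} := [ffun e => A e : nat].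
exists {A : {ffun E -> 'I_#|V|} | `[< spanning_multi_tree (nat_of A) >]}.
exists (fun B => [ffun e => (nat_of (val B) e)%:R]).
apply/seteqP; split=> [_ [A treeA <-]|_ [[A /= treeA] _ <-]]; last first.
  by exists (nat_of A) => //; apply/asboolP.
have A_lt e : (A e < #|V|)%N.
  have [_ _ sumA] := treeA; have := vertex_gt0 H.
  by move: sumA; rewrite (bigD1 e) //=; lia.
pose A' := [ffun e => Ordinal (A_lt e)].
have A'E : nat_of A' = A by apply/ffunP => e; rewrite !ffunE.
have A'P : `[< spanning_multi_tree (nat_of A') >] by apply/asboolP; rewrite A'E.
by exists (exist _ A' A'P) => //=; rewrite A'E.
Qed.

Lemma Adm_blocker_pairing eta rho :
  Adm (blocker Omega) eta -> Adm Omega rho -> 1 <= \sum_e eta e * rho e.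
Proof.
have [I [G ->]] := multi_tree_family_range => -[eta0 eta1] /(extreme_point_below eta0).
case=> x ex; apply: le_trans; apply: le_trans (eta1 _ ex) _.
by under eq_bigr do rewrite mulrC.
Qed.

Lemma Adm_blocker_tree A :
  spanning_multi_tree A -> Adm (blocker Omega) [ffun e => (A e)%:R].
Proof.
move=> treeA; split=> [e|rho [[_ rho1] _]]; first by rewrite ffunE.
have := rho1 [ffun e => (A e)%:R]; under eq_bigr do rewrite mulrC.
by apply; exists A.
Qed.

(** * First-order optimality for the modulus *)

Lemma Adm_convex (Gamma : set {ffun E -> R}) (x y : {ffun E -> R}) t : 0 <= t <= 1 ->
  Adm Gamma x -> Adm Gamma y -> Adm Gamma [ffun e => (1 - t) * x e + t * y e].
Proof.
move=> /andP[t0 t1] [x0 Gx] [y0 Gy]; split=> [e|gamma Gg].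
  by rewrite ffunE addr_ge0 ?mulr_ge0 ?subr_ge0.
rewrite (_ : \sum_e _ = (1 - t) * (\sum_e gamma e * x e) + t * \sum_e gamma e * y e).
  have := ler_wpM2l t0 (Gy _ Gg).
  have t1' : 0 <= 1 - t by rewrite subr_ge0.
  have := ler_wpM2l t1' (Gx _ Gg).
  lra.
rewrite !mulr_sumr -big_split; apply: eq_bigr => e _; rewrite ffunE /=; ring.
Qed.

Lemma Mod2_le (Gamma : set {ffun E -> R}) rho : Adm Gamma rho -> Mod2 Gamma <= energy2 rho.
Proof.
move=> Arho; apply: ge_inf; last by exists rho.
by exists 0 => _ [x _ <-]; apply: sumr_ge0 => e _; rewrite sqr_ge0.
Qed.

(** Otherwise a short move from [x] towards [y], admissible by convexity, would lower the energy. *)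
Lemma Mod2_minimizer_variation (Gamma : set {ffun E -> R}) (x y : {ffun E -> R}) :
  Mod2_minimizer Gamma x -> Adm Gamma y -> 0 <= \sum_e x e * (y e - x e).
Proof.
move=> [Ax xmin] Ay; rewrite leNgt; apply/negP => lt0.
set a := \sum_e _ in lt0; pose b := \sum_e (y e - x e) ^+ 2.
have b0 : 0 <= b by apply: sumr_ge0 => e _; rewrite sqr_ge0.
(* The energy changes by t (2 a + t b). This [t] lies in (0, 1] even when [b] is 0, and turns the
   bracket into a + t a, which is negative. *)
pose t := - a / (b - a); have ba : 0 < b - a by rewrite subr_gt0 (lt_le_trans lt0).
have tba : t * (b - a) = - a by rewrite divfK ?gt_eqF.
have t0 : 0 < t by rewrite divr_gt0 ?oppr_gt0.
have t1 : t <= 1 by rewrite ler_pdivrMr // mul1r lerDr.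
have t01 : 0 <= t <= 1 by rewrite ltW.
have := Mod2_le (Adm_convex t01 Ax Ay); rewrite -xmin {2}/energy2.
rewrite (_ : \sum_e _ = energy2 x + t * (2 * a + t * b)); last first.
  rewrite /energy2 /a /b !mulr_sumr -big_split mulr_sumr -big_split.
  by apply: eq_bigr => e _; rewrite ffunE /=; ring.
rewrite lerDl pmulr_rge0 //.
have : t * a < 0 by rewrite pmulr_rlt0.
move: tba; lra.
Qed.

(** * Homogeneity as sparsity *)

Lemma card_hyperedge_gt0 : connected H -> (2 <= #|V|)%N -> (0 < #|E|)%N.
Proof.
move=> connH V2; have [v _] := card_gt0P (vertex_gt0 H).
have [||e _] := connH [set v]%SET; last by apply/card_gt0P; exists e.
  by apply/set0Pn; exists v; rewrite inE.
by apply: contraTneq V2 => vT; rewrite -cardsT -vT cards1.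
Qed.

(** Of the |V| - 1 members of a multi-tree at most |X| - 1 lie in [X], so at least |V| - |X| do
    not. *)
Lemma Adm_outside X : X != finset.set0 -> X != finset.setT ->
  Adm Omega [ffun e => (e \notin edges_in X)%:R / (#|V|%:R - #|X|%:R)].
Proof.
move=> X0 XT; have ltX : (#|X| < #|V|)%N.
  by rewrite -cardsT proper_card ?finset.properT.
have pos : 0 < #|V|%:R - #|X|%:R :> R by rewrite subr_gt0 ltr_nat.
split=> [e|_ [A [_ forA sumA] <-]]; first by rewrite ffunE divr_ge0 // ltW.
rewrite (_ : \sum_e _ = (\sum_(e | e \notin edges_in X) A e)%:R / (#|V|%:R - #|X|%:R)).
  rewrite ler_pdivlMr // mul1r -natrB ?(ltnW ltX) // ler_nat.
  move: sumA (forA _ X0); rewrite (bigID [in edges_in X]) /=.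
  by have := X0; rewrite -card_gt0; lia.
rewrite natr_sum mulr_suml [RHS]big_mkcond; apply: eq_bigr => e _; rewrite !ffunE.
by case: (e \notin _); rewrite /= ?mul0r ?mulr0 // mul1r.
Qed.

Lemma edges_inT : edges_in (finset.setT : {set V}) = finset.setT.
Proof. by apply/setP => e; rewrite !inE finset.subsetT. Qed.

Let c0 : R := (#|V|%:R - 1) / #|E|%:R.

Lemma homogeneous_sparse : connected H -> (2 <= #|V|)%N -> homogeneous R H <-> sparse c0.
Proof.
move=> connH V2; have E0 := card_hyperedge_gt0 connH V2.
have E0R : 0 < #|E|%:R :> R by rewrite ltr0n.
have V1 : 0 < #|V|%:R - 1 :> R by rewrite subr_gt0 ltr1n.
have c0E : c0 * #|E|%:R = #|V|%:R - 1 by rewrite divfK ?gt_eqF.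
have c0_gt0 : 0 < c0 by rewrite divr_gt0.
split=> [[eta [[etamin _] [c etac]]]|spc].
  have [[eta0 _] _] := etamin.
  have c_ge0 : 0 <= c by have [e _] := card_gt0P E0; rewrite -(etac e).
  have c_le : c <= c0.
    have sE : forall e, e \in enum E by move=> e; rewrite mem_enum.
    have treeA := greedy_spanning connH V2 sE; set A := finfun _ in treeA.
    have := Mod2_minimizer_variation etamin (Adm_blocker_tree treeA).
    rewrite (_ : \sum_e _ = c * ((\sum_e A e)%:R - c * #|E|%:R)); last first.
      rewrite natr_sum -sum1_card natr_sum mulr_sumr -sumrB mulr_sumr.
      by apply: eq_bigr => e _; rewrite etac ffunE mulr1.
    have [_ _ ->] := treeA; rewrite natrB ?(ltnW V2) //.
    (* The variational inequality reads c (|V| - 1 - c |E|) >= 0, which is vacuous for c = 0. *)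
    have [->|c_neq0] := eqVneq c 0; first by rewrite (ltW c0_gt0).
    rewrite pmulr_rge0 ?lt_def ?c_neq0 // subr_ge0 -c0E.
    by rewrite ler_pM2r.
  move=> X X0; have [->|XT] := eqVneq X finset.setT.
    by rewrite edges_inT !cardsT c0E.
  have [Aeta _] := etamin.
  have := Adm_blocker_pairing Aeta (Adm_outside X0 XT).
  have pos : 0 < #|V|%:R - #|X|%:R :> R.
    by rewrite subr_gt0 ltr_nat -cardsT proper_card ?finset.properT.
  rewrite (_ : \sum_e _ = c * #|~: edges_in X|%:R / (#|V|%:R - #|X|%:R)); last first.
    rewrite -[#|~: _|]sum1_card natr_sum mulr_sumr mulr_suml [RHS]big_mkcond /=.
    apply: eq_bigr => e _; rewrite etac ffunE finset.in_setC.
    by case: (e \notin _); rewrite /= ?mul0r ?mulr0 // mul1r mulr1.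
  (* With m hyperedges outside E[X], |V| - |X| <= c m <= c0 m = |V| - 1 - c0 |E[X]|. *)
  rewrite ler_pdivlMr // mul1r => le1.
  have le2 : c * #|~: edges_in X|%:R <= c0 * #|~: edges_in X|%:R by rewrite ler_wpM2r.
  have := c0E; rewrite -(cardsC (edges_in X)) natrD.
  by lra.
pose eta : {ffun E -> R} := [ffun=> c0].
have etaE : energy2 eta = c0 * (#|V|%:R - 1).
  rewrite /energy2; under eq_bigr do rewrite ffunE.
  by rewrite sumr_const -c0E -[LHS]mulr_natr expr2; ring.
have Aeta : Adm (blocker Omega) eta.
  split=> [e|rho [[_ rho1] _]]; first by rewrite ffunE ltW.
  have [A treeA le] := light_spanning_multi_tree rho connH V2 (ltW c0_gt0) spc c0E.
  have /rho1 : Omega [ffun e => (A e)%:R] by exists A.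
  under eq_bigr do rewrite ffunE.
  move=> /le_trans/(_ le)/le_trans; apply; rewrite mulr_sumr.
  by apply: ler_sum => e _; rewrite ffunE mulrC.
have Aunif : Adm Omega [ffun=> (#|V|%:R - 1)^-1].
  split=> [e|_ [A [_ _ sumA] <-]]; first by rewrite ffunE invr_ge0 ltW.
  under eq_bigr do rewrite !ffunE.
  by rewrite -mulr_suml -natr_sum sumA natrB ?(ltnW V2) // divff ?gt_eqF.
(* Pairing with the uniform density bounds the sum of [rho] below by |V| - 1. Keeping the square
   term yields both minimality and uniqueness. *)
have energy_ge rho : Adm (blocker Omega) rho ->
    energy2 eta + \sum_e (rho e - c0) ^+ 2 <= energy2 rho.
  move=> /Adm_blocker_pairing/(_ Aunif); under eq_bigr do rewrite ffunE.
  rewrite -mulr_suml ler_pdivlMr // mul1r => le.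
  have -> : energy2 rho = \sum_e (rho e - c0) ^+ 2 + 2 * c0 * (\sum_e rho e)
      - c0 * (c0 * #|E|%:R).
    rewrite -sum1_card natr_sum !mulr_sumr -big_split -sumrB.
    by apply: eq_bigr => e _ /=; ring.
  rewrite etaE c0E.
  have := ler_wpM2l (ltW c0_gt0) le.
  lra.
have etamin : energy2 eta = Mod2 (blocker Omega).
  apply/eqP; rewrite eq_le Mod2_le // andbT; apply: lb_le_inf.
    by exists (energy2 eta); exists eta.
  move=> _ [rho /energy_ge + <-]; apply: le_trans.
  by rewrite lerDl sumr_ge0 // => e _; rewrite sqr_ge0.
exists eta; split; last by exists c0 => e; rewrite ffunE.
split=> // rho [/energy_ge le rhomin].
have : \sum_e (rho e - c0) ^+ 2 <= 0 by move: le; rewrite rhomin -etamin; lra.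
move=> le0; apply/ffunP => e; rewrite ffunE; apply/eqP; rewrite -subr_eq0 -sqrf_eq0.
rewrite eq_le sqr_ge0 andbT; apply: le_trans le0.
by rewrite (bigD1 e) //= lerDl sumr_ge0 // => e' _; rewrite sqr_ge0.
Qed.

(** * Strength and fractional arboricity as sparsity *)

Lemma across_monochromatic (P : {set {set V}}) e u v : finset.partition P finset.setT ->
  e \notin edges_across P -> u \in ends e -> v \in ends e -> finset.pblock P u = finset.pblock P v.
Proof.
move=> /and3P[/eqP covP tiP _]; rewrite inE -ltnNge ltnS => /card_le1_eqP one ue ve.
have blk w : w \in ends e ->
    finset.pblock P w \in [set B in P | ends e :&: B != finset.set0]%SET.
  move=> we; have wP : w \in finset.cover P by rewrite covP inE.
  rewrite inE finset.pblock_mem //; apply/set0Pn; exists w.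
  by rewrite inE we finset.mem_pblock.
by apply: one; apply: blk.
Qed.

Lemma imset_pblock (P : {set {set V}}) : finset.partition P finset.setT ->
  (finset.pblock P @: finset.setT)%SET = P.
Proof.
move=> /and3P[/eqP covP tiP P0]; apply/setP => B; apply/imsetP/idP.
  by case=> v _ ->; rewrite finset.pblock_mem // covP inE.
move=> BP; have /set0Pn[v vB] : B != finset.set0 by apply: contraNneq P0 => <-.
by exists v; rewrite ?inE // (finset.def_pblock tiP BP vB).
Qed.

Lemma sparse_strength_arboricity : connected H -> (2 <= #|V|)%N ->
  sparse c0 <-> strength H R = fractional_arboricity H R.
Proof.
move=> connH V2; have E0 := card_hyperedge_gt0 connH V2.
have E0R : 0 < #|E|%:R :> R by rewrite ltr0n.
have V1 : 0 < #|V|%:R - 1 :> R by rewrite subr_gt0 ltr1n.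
have c0E : c0 * #|E|%:R = #|V|%:R - 1 by rewrite divfK ?gt_eqF.
have c0_gt0 : 0 < c0 by rewrite divr_gt0.
set Sset := [set #|edges_across P|%:R / (#|P|%:R - 1 : R) | P in
  [set P : {set {set V}} | finset.partition P finset.setT && (2 <= #|P|)%N]]%classic.
set Dset := [set #|edges_in X|%:R / (#|X|%:R - 1 : R) | X in
  [set X : {set V} | (2 <= #|X|)%N]]%classic.
have DE : Dset c0^-1.
  by exists finset.setT; rewrite /= ?cardsT // edges_inT cardsT invf_div.
have SE : Sset c0^-1.
  pose P : {set {set V}} := (finset.set1 @: finset.setT)%SET.
  have cP : #|P| = #|V| by rewrite card_imset ?cardsT //; apply: finset.set1_inj.
  have partP : finset.partition P finset.setT.
    apply/and3P; split.
    - rewrite finset.eqEsubset finset.subsetT; apply/fintype.subsetP => v _.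
      by apply/bigcupP; exists [set v]%SET; rewrite ?inE //; apply: imset_f.
    - apply/finset.trivIsetP => _ _ /imsetP[u _ ->] /imsetP[v _ ->] uv.
      by rewrite disjoints1 inE; apply: contraNneq uv => ->.
    - by apply/imsetP => -[v _ /setP/(_ v)]; rewrite !inE eqxx.
  exists P; first by rewrite /= partP cP.
  rewrite cP invf_div; congr (_%:R / _); rewrite -cardsT.
  congr #|pred_of_set _|; apply/setP => e; rewrite !inE.
  (* The singletons of the ends of [e] are distinct parts that [e] meets, so every hyperedge
     crosses. *)
  apply: leq_trans (ends_gt1 e) _; rewrite -(card_imset _ (@finset.set1_inj V)).
  apply: subset_leq_card; apply/fintype.subsetP => _ /imsetP[v ve ->].
  rewrite inE imset_f //; apply/set0Pn; exists v; by rewrite !inE ve /=.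
have X1 X : (2 <= #|X|)%N -> 0 < #|X|%:R - 1 :> R by rewrite subr_gt0 ltr1n.
have P1 (P : {set {set V}}) : (2 <= #|P|)%N -> 0 < #|P|%:R - 1 :> R.
  by rewrite subr_gt0 ltr1n.
have ubD : has_ubound Dset.
  exists #|E|%:R => _ [X /= X2 <-]; rewrite ler_pdivrMr ?X1 //.
  apply: (@le_trans _ _ #|E|%:R); first by rewrite ler_nat max_card.
  by rewrite ler_peMr // lerBrDr -(natrD _ 1 1) ler_nat.
have lbS : has_lbound Sset.
  by exists 0 => _ [P /andP[_ P2] <-]; rewrite divr_ge0 // ltW ?P1.
split=> [spc|SD].
  have D : sup Dset = c0^-1.
    apply/eqP; rewrite eq_le ub_le_sup // andbT; apply: ge_sup; first by exists c0^-1.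
    move=> _ [X X2 <-]; rewrite ler_pdivrMr ?X1 // ler_pdivlMl //; apply: spc.
    by rewrite -card_gt0 ltnW.
  have S : inf Sset = c0^-1.
    apply/eqP; rewrite eq_le ge_inf //=; apply: lb_le_inf; first by exists c0^-1.
    move=> _ [P /andP[partP P2] <-]; rewrite ler_pdivlMr ?P1 // ler_pdivrMl //.
    have mono e u v : e \in (~: edges_across P)%SET -> u \in ends e -> v \in ends e ->
        finset.pblock P u = finset.pblock P v.
      by rewrite finset.in_setC; apply: across_monochromatic.
    (* Uncrossed hyperedges have weight at most |V| - |P|; subtracting from c0 |E| = |V| - 1 leaves
       at least |P| - 1 for the crossing ones. *)
    have := sparse_monochromatic (ltW c0_gt0) spc mono.
    rewrite imset_pblock //.
    have := c0E; rewrite -(cardsC (edges_across P)) natrD; lra.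
  by rewrite /strength /fractional_arboricity S D.
have S_le : strength H R <= c0^-1 by apply: ge_inf.
(* A singleton contributes no ratio to D, but it contains no hyperedge. *)
move=> X X0; have [X2|X2] := leqP 2 #|X|; last first.
  have X1' : #|X| = 1%N by move: X0 X2; rewrite -card_gt0; lia.
  rewrite X1' subrr (_ : edges_in X = finset.set0) ?cards0 ?mulr0 //.
  apply/setP => e; rewrite !inE; apply: contraTF (ends_gt1 e).
  by move=> /subset_leq_card; rewrite X1' -leqNgt.
have : #|edges_in X|%:R / (#|X|%:R - 1) <= c0^-1.
  by apply: le_trans S_le; rewrite SD; apply: ub_le_sup => //; exists X.
by rewrite ler_pdivrMr ?X1 // ler_pdivlMl.
Qed.

End Homogeneity.

Theorem theorem1p13 (R : realType) (H : hypergraph)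
    (connH : connected H) (V_ge2 : 2 <= #|vertex H|) :
  homogeneous R H <-> strength H R = fractional_arboricity H R.
Proof.
by rewrite (homogeneous_sparse R connH V_ge2); apply: sparse_strength_arboricity.
Qed.
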